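(* Let $\rho\in(0,1)$ and consider the geometric-horizon single-call model with independent valuations. The optimization problem $$\max\big\{F(S):\ S\subseteq\mathcal{C},\ |\{e\in S: i_e=i\}|\le 1\ \ \forall i\in I\big\}$$ is the maximization of a monotone submodular function $F$ under a partition matroid constraint; hence continuous greedy plus pipage rounding yields a $(1-1/e)$-approximation for it.
   Context: $I$ is a finite set of agents with mutually independent random values $V_i\ge0$. Each agent $i$ has a finite set $M_i\subset\mathbb{R}_{\ge0}$ of candidate prices. A call is a pair $e=(i_e,r_e)$ with $i_e\in I$, $r_e\in M_{i_e}$; $\mathcal C$ is the finite set of calls, and $p_e=\Pr[V_{i_e}\ge r_e]$. Geometric horizon: after each rejection the process survives with probability $\rho$, i.e. the number $N$ of available calls, independent of $V$, satisfies $\Pr[N\ge t]=\rho^{t-1}$ for $t\ge1$. Define the score $$\mathrm{Score}_\rho(e)=\frac{r_e\,p_e}{p_e+(1-p_e)(1-\rho)}.$$ The score order is the total order on $\mathcal C$ sorting calls by nonincreasing $\mathrm{Score}_\rho$, with ties broken deterministically. For $S\subseteq\mathcal C$ listed in score order as $e_1,\dots,e_k$, $F(S)$ is the expected revenue of executing $S$ in this order, stopping at the first acceptance or when the horizon is exhausted, with acceptance events of distinct calls independent: $$F(S)=\sum_{j=1}^k \rho^{\,j-1}\, r_{e_j}\,p_{e_j}\prod_{s<j}(1-p_{e_s}).$$ ''Continuous greedy plus pipage rounding'' is the standard algorithm of Calinescu, Chekuri, Pál and Vondrák for monotone submodular maximization over a matroid with a value oracle (approximately maximize the multilinear extension over the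 matroid polytope, then round to an independent set). A $(1-1/e)$-approximation returns a feasible $S$ with $F(S)\ge(1-1/e)$ times the maximum. *)

(* Defs.v *)
From HB Require Import structures.
From mathcomp Require Import all_boot all_order all_algebra.
From mathcomp Require Import finmap.
From mathcomp Require Import all_classical all_reals all_analysis.

Set Implicit Arguments.
Unset Strict Implicit.
Unset Printing Implicit Defensive.
Import Order.TTheory GRing.Theory Num.Theory.
Local Open Scope ring_scope.

Definition monotone_fun (R : realType) (T : finType) (f : {set T} -> R) : Prop :=
  forall A B : {set T}, A \subset B -> f A <= f B.

Definition submodular (R : realType) (T : finType) (f : {set T} -> R) : Prop :=
  forall A B : {set T}, f (A :|: B) + f (A :&: B) <= f A + f B.

Definition is_matroid (T : finType) (indep : pred {set T}) : Prop :=
  [/\ indep finset.set0,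
      forall A B : {set T}, A \subset B -> indep B -> indep A
    & forall A B : {set T}, indep A -> indep B -> (#|A| < #|B|)%N ->
        exists2 x, x \in B :\: A & indep (x |: A)].

Definition is_partition_matroid (T : finType) (indep : pred {set T}) : Prop :=
  is_matroid indep /\
  exists (Q : {set {set T}}) (cap : {set T} -> nat),
    finset.partition Q [set: T]%SET /\
    forall S : {set T}, indep S = [forall X in Q, #|S :&: X| <= cap X]%N.

Definition matroid_rank (T : finType) (indep : pred {set T}) (A : {set T}) : nat :=
  \max_(S : {set T} | indep S && (S \subset A)) #|S|.

Definition is_base (T : finType) (indep : pred {set T}) (B : {set T}) : bool :=
  indep B && (#|B| == matroid_rank indep [set: T]%SET).

(* Only used for f >= 0, so that starting the maximum from f set0 is harmless
   as soon as set0 is independent. *)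
Definition opt (R : realType) (T : finType) (f : {set T} -> R)
    (indep : pred {set T}) : R :=
  \big[Num.max/f finset.set0]_(S : {set T} | indep S) f S.

Definition is_approx_solution (R : realType) (T : finType) (c : R)
    (f : {set T} -> R) (indep : pred {set T}) (S : {set T}) : Prop :=
  indep S /\ forall S' : {set T}, indep S' -> c * f S' <= f S.

(* Law of the random set containing each j independently with probability y j. *)
Definition random_set_law (R : realType) (T : finType) (y : T -> R)
    (S : {set T}) : R :=
  (\prod_(j in S) y j) * \prod_(j in ~: S) (1 - y j).

Definition multilinear (R : realType) (T : finType) (f : {set T} -> R)
    (y : T -> R) : R :=
  \sum_(S : {set T}) random_set_law y S * f S.

(* Expected marginal value of j with respect to the random set drawn from y. *)
Definition exp_marginal (R : realType) (T : finType) (f : {set T} -> R)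
    (y : T -> R) (j : T) : R :=
  \sum_(S : {set T}) random_set_law y S * (f (j |: S) - f S).

Definition is_max_weight_base (R : realType) (T : finType)
    (indep : pred {set T}) (w : T -> R) (B : {set T}) : bool :=
  is_base indep B &&
  [forall B' : {set T}, is_base indep B' ==> (\sum_(j in B') w j <= \sum_(j in B) w j)].

Definition max_weight_base (R : realType) (T : finType)
    (indep : pred {set T}) (w : T -> R) : {set T} :=
  odflt finset.set0 [pick B | is_max_weight_base indep w B].

(* The fractional point after k steps of length 1 / K, when the k-th step uses
   the weights w k; the output of the phase is the point after K steps. *)
Fixpoint continuous_greedy (R : realType) (T : finType) (indep : pred {set T})
    (K : nat) (w : nat -> T -> R) (k : nat) : T -> R :=
  if k is k'.+1 then
    fun j => continuous_greedy indep K w k' j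
             + K%:R^-1 * (j \in max_weight_base indep (w k'))%:R
  else fun=> 0.

(* The weights of each step estimate the expected marginals at the current
   point up to (step length) * OPT, the accuracy that averaging sampled values
   of f is meant to provide; exact marginals are allowed.  As w is arbitrary,
   the estimates may depend on the history of the run. *)
Definition accurate_weights (R : realType) (T : finType) (f : {set T} -> R)
    (indep : pred {set T}) (K : nat) (w : nat -> T -> R) : Prop :=
  forall (k : nat) (j : T), (k < K)%N ->
    `|w k j - exp_marginal f (continuous_greedy indep K w k) j|
      <= K%:R^-1 * opt f indep.

(* The largest e such that moving mass e from j to i keeps y nonnegative and
   does not violate any rank constraint \sum_(k in A) y k <= rank A. *)
Definition hit_constraint (R : realType) (T : finType) (indep : pred {set T})
    (y : T -> R) (i j : T) : R :=
  \big[Num.min/y j]_(A : {set T} | (i \in A) && (j \notin A))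
     ((matroid_rank indep A)%:R - \sum_(k in A) y k).

Definition move_mass (R : realType) (T : finType) (indep : pred {set T})
    (y : T -> R) (i j : T) : T -> R :=
  fun k => y k + hit_constraint indep y i j * ((k == i)%:R - (k == j)%:R).

(* For y in the base polytope, two elements that can exchange mass in both
   directions are two fractional elements lying in exactly the same tight sets.
   Of the two ends of the segment of feasible points through y, the one with
   the larger multilinear extension is kept. *)
Definition pipage_step (R : realType) (T : finType) (f : {set T} -> R)
    (indep : pred {set T}) (y : T -> R) : T -> R :=
  if [pick ij : T * T | [&& ij.1 != ij.2,
        0 < hit_constraint indep y ij.1 ij.2
      & 0 < hit_constraint indep y ij.2 ij.1]] is Some ij then
    let yl := move_mass indep y ij.1 ij.2 in
    let yr := move_mass indep y ij.2 ij.1 in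
    if multilinear f yr <= multilinear f yl then yl else yr
  else y.

(* Each step strictly decreases the dimension of the face of the base polytope
   containing y, hence #|T| steps reach a vertex, i.e. a base. *)
Definition pipage_round (R : realType) (T : finType) (f : {set T} -> R)
    (indep : pred {set T}) (y : T -> R) : {set T} :=
  [set j | iter #|T| (pipage_step f indep) y j == 1]%SET.

Definition continuous_greedy_pipage (R : realType) (T : finType)
    (f : {set T} -> R) (indep : pred {set T}) (K : nat) (w : nat -> T -> R) :
    {set T} :=
  pipage_round f indep (continuous_greedy indep K w K).

(* Number of steps that is enough for the guarantee 1 - 1/e to hold without
   an error term: n is the size of the ground set and d the rank. *)
Definition enough_steps (T : finType) (indep : pred {set T}) (K : nat) : Prop :=
  (0 < K)%N /\ (64 * #|T| * matroid_rank indep [set: T]%SET ^ 2 <= K)%N.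

Definition mutually_independent d (Omega : measurableType d) (R : realType)
    (P : probability Omega R) (I : finType) (V : I -> {RV P >-> R}) : Prop :=
  forall (J : {set I}) (B : I -> set R), (forall i, measurable (B i)) ->
    P (\bigcap_(i in [set i | i \in J]) (V i @^-1` B i))%classic =
    (\prod_(i in J) P (V i @^-1` B i)%classic)%E.

(* Independence of N from the whole family V, tested on measurable
   rectangles, which generate the sigma-algebra of V and are stable under
   intersection. *)
Definition horizon_independent d (Omega : measurableType d) (R : realType)
    (P : probability Omega R) (I : finType) (V : I -> {RV P >-> R})
    (N : {RV P >-> nat}) : Prop :=
  forall (A : set nat) (B : I -> set R), (forall i, measurable (B i)) ->
    P ((N @^-1` A) `&` \bigcap_i (V i @^-1` B i))%classic =
    (P (N @^-1` A)%classic * P (\bigcap_i (V i @^-1` B i))%classic)%E.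

Definition geometric_horizon d (Omega : measurableType d) (R : realType)
    (P : probability Omega R) (N : {RV P >-> nat}) (rho : R) : Prop :=
  forall t : nat, (1 <= t)%N ->
    P [set w | (t <= N w)%N]%classic = (rho ^+ (t - 1))%:E.

(* An agent together with one of its candidate prices. *)
Definition call (R : realType) (I : finType) (M : I -> {fset R}) : finType :=
  {i : I & M i}.

Definition agent (R : realType) (I : finType) (M : I -> {fset R})
  (e : call M) : I := tag e.

Definition price (R : realType) (I : finType) (M : I -> {fset R})
  (e : call M) : R := fsval (tagged e).

Definition accept_prob d (Omega : measurableType d) (R : realType)
    (P : probability Omega R) (I : finType) (V : I -> {RV P >-> R})
    (M : I -> {fset R}) (e : call M) : R :=
  fine (P [set w | price e <= V (agent e) w]%classic).

Definition score d (Omega : measurableType d) (R : realType)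
    (P : probability Omega R) (I : finType) (V : I -> {RV P >-> R})
    (M : I -> {fset R}) (rho : R) (e : call M) : R :=
  let p := accept_prob V e in
  price e * p / (p + (1 - p) * (1 - rho)).

(* [before e e'] means that e precedes or equals e'; the order among calls of
   equal score is arbitrary but fixed. *)
Definition score_order d (Omega : measurableType d) (R : realType)
    (P : probability Omega R) (I : finType) (V : I -> {RV P >-> R})
    (M : I -> {fset R}) (rho : R) (before : rel (call M)) : Prop :=
  [/\ total before, transitive before, antisymmetric before
    & forall e e', before e e' -> score V rho e' <= score V rho e].

(* Indices start from 0 here, so the j-th call carries the factor rho ^+ j. *)
Definition revenue d (Omega : measurableType d) (R : realType)
    (P : probability Omega R) (I : finType) (V : I -> {RV P >-> R})
    (M : I -> {fset R}) (rho : R) (before : rel (call M))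
    (S : {set call M}) : R :=
  let e := in_tuple (sort before (enum S)) in
  \sum_(j < size (sort before (enum S)))
    rho ^+ j * (price (tnth e j) * accept_prob V (tnth e j)) *
    \prod_(s < size (sort before (enum S)) | (s < j)%N)
      (1 - accept_prob V (tnth e s)).

Definition feasible (R : realType) (I : finType) (M : I -> {fset R})
    (S : {set call M}) : bool :=
  [forall i : I, #|[set e in S | agent e == i]%SET| <= 1]%N.

(* Main.v *)
Require Import Defs.
From mathcomp Require Import all_boot all_order all_algebra.
From mathcomp Require Import finmap.
From mathcomp Require Import all_classical all_reals all_analysis.
From mathcomp Require Import finset zify ring lra.

Set Implicit Arguments.
Unset Strict Implicit.
Unset Printing Implicit Defensive.
Import Order.TTheory GRing.Theory Num.Theory.
Local Open Scope ring_scope.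

(** The revenue.  Put q(e) = rho (1 - p(e)), the probability that the process
goes on after the call e.  The denominator of the score is 1 - q(e), so the
revenue r(e) p(e) equals (1 - q(e)) s(e), where s is the score.  Hence F(S) is
the expected score of the first call at which the process stops; as calls are
made by nonincreasing score, it is also the expected largest score in a random
subset of S that keeps each e independently with probability 1 - q(e), and such
functions are monotone and submodular.  Concretely, if m bounds all scores, the
loss m - F is built from constants by repeatedly multiplying by the factor
(q(e) if e belongs to S, 1 otherwise) and adding a nonnegative constant; both
operations preserve nonnegative antitone supermodular functions
([chain_loss_supermodular]).

The greedy phase.  Let D = 1/K, OPT = 1, n the size of the ground set, d the
rank, and F_k the multilinear extension at the k-th fractional point y_k.  Let
B_k be the base selected at step k, G_k the sum over B_k of the expected
marginals g(b), and h(b) = g(b) / (1 - y_k(b)) the partial derivatives.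
Submodularity and the accuracy of the weights give G_k >= 1 - F_k - 2dD, and a
second-order expansion shows that F_{k+1} - F_k is at most the sum over B_k of
D h(b), and falls short of it by at most D^2 d(d-1)/2
([multilinear_raise_second_order]).  Without further care this yields 1 - 1/e
up to an error of at most 1/(32n).  The error is absorbed by the surplus
h - g = y h of partial derivatives over marginals.  An element j that has
received total gain A_j has y(j) >= A_j, because no marginal exceeds OPT, so its
accumulated surplus is at least about A_j^2 / 2 ([received_bonus]).  The A_j and
the surpluses add up to at least F_K, which is close to 1 - 1/e, and there are
n elements, so the total surplus is at least 3/(32n): either the surplus is
that large already, or the A_j add up to at least 0.475 and their squares to
enough.  At least a third of the surplus survives the contraction
(1 - D)^K of the remaining steps, which pays for the error
([error_terms_absorbed]).

The rounding phase.  For a partition matroid with unit capacities, the base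
polytope consists of the vectors that are a probability distribution on each
class.  Two elements can exchange mass in both directions exactly when they
are in the same class and both carry mass, and the exchange then empties one of
them.  Along the direction of an exchange the multilinear extension is convex,
as mixed second derivatives are nonpositive, so one of the two ends is at least
as good as the current point ([pipage_stepP]).  The support shrinks at each
exchange, so after as many steps as there are elements the point is the
indicator of an independent set ([pipage_roundP]). *)

(** * Calculus of the multilinear extension *)

Section Multilinear.
Variables (R : realType) (T : finType).
Implicit Types (f h : {set T} -> R) (y : T -> R) (S A B : {set T}) (s : seq T).

(** The coordinates to raise form a list because they are raised one at a time. *)
Definition raise y (t : R) s : T -> R := fun k => y k + t * (k \in s)%:R.

(** The partial derivative in direction i of the multilinear extension of h is
the multilinear extension of this function.  Removing i first makes it blind to
whether i is in S, which is why that derivative does not depend on the i-th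
coordinate. *)
Definition set_deriv h (i : T) : {set T} -> R := fun S => h (i |: S) - h (S :\ i).

Definition in_cube y := forall k, 0 <= y k <= 1.

Lemma eq_multilinear h y y' : y =1 y' -> multilinear h y = multilinear h y'.
Proof. by move=> /funext ->. Qed.

Lemma random_set_lawE y S :
  random_set_law y S = \prod_j (if j \in S then y j else 1 - y j).
Proof.
rewrite /random_set_law (bigID (mem S) xpredT) /=; congr (_ * _).
  by apply: eq_bigr => j ->.
by apply: eq_big => j; rewrite ?inE // => /negbTE ->.
Qed.

Lemma random_set_law_ge0 y S : in_cube y -> 0 <= random_set_law y S.
Proof.
move=> cy; rewrite random_set_lawE prodr_ge0// => j _.
by case: ifP => _; rewrite ?subr_ge0; case/andP: (cy j).
Qed.

Let law_but y i S := \prod_(j | j != i) (if j \in S then y j else 1 - y j).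

(** Conditioning on whether i is drawn exhibits the extension as affine in the
i-th coordinate, with coefficients that depend on the other coordinates only. *)
Lemma multilinear_condition i h y :
  multilinear h y = \sum_(S : {set T} | i \notin S)
    law_but y i S * ((1 - y i) * h S + y i * h (i |: S)).
Proof.
rewrite /multilinear (bigID (fun S : {set T} => i \notin S)) /=.
under [RHS]eq_bigr do rewrite mulrDr.
rewrite big_split /=; congr (_ + _).
  apply: eq_bigr => S /negbTE iS.
  by rewrite random_set_lawE (bigD1 i)//= iS mulrA [law_but _ _ _ * _]mulrC.
rewrite (reindex_onto (fun S => i |: S) (fun S => S :\ i)) /=; last first.
  by move=> S; rewrite negbK; exact: setD1K.
apply: eq_big => [S|S].
  rewrite setU11 /=; apply/eqP/idP => [<-|]; [by rewrite setD11 | exact: setU1K].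
move=> _.
rewrite random_set_lawE (bigD1 i)//= setU11 mulrA [law_but _ _ _ * _]mulrC.
congr (_ * _ * _); apply: eq_bigr => j ji; by rewrite in_setU1 (negbTE ji).
Qed.

Lemma multilinear_cst (c : R) y : multilinear (fun=> c) y = c.
Proof.
rewrite /multilinear -mulr_suml (eq_bigr _ (fun S _ => random_set_lawE y S)).
by rewrite -bigA_distr big1 ?mul1r// => j _; rewrite /= addrC subrK.
Qed.

Lemma multilinearD h h' y :
  multilinear (fun S => h S + h' S) y = multilinear h y + multilinear h' y.
Proof. by rewrite -big_split; apply: eq_bigr => S _; rewrite mulrDr. Qed.

Lemma multilinear_sum (s : seq T) (h : T -> {set T} -> R) y :
  multilinear (fun S => \sum_(j <- s) h j S) y = \sum_(j <- s) multilinear (h j) y.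
Proof.
rewrite exchange_big; apply: eq_bigr => S _; by rewrite mulr_sumr.
Qed.

Lemma ler_multilinear h h' y : in_cube y -> (forall S, h S <= h' S) ->
  multilinear h y <= multilinear h' y.
Proof.
by move=> cy hh'; apply: ler_sum => S _; rewrite ler_wpM2l ?random_set_law_ge0.
Qed.

Lemma multilinear_indicator h S : multilinear h (fun j => (j \in S)%:R) = h S.
Proof.
rewrite /multilinear (bigD1 S)//= [X in X * _]random_set_lawE big1 => [|j _]; last first.
  by case: (j \in S); rewrite ?subr0.
rewrite mul1r big1 ?addr0// => S' S'S; rewrite random_set_lawE.
suff [j jS] : exists j, (j \in S') != (j \in S).
  rewrite (bigD1 j)//=; move: jS.
  by case: (j \in S'); case: (j \in S) => //= _; rewrite ?subrr !mul0r.
apply/fintype.existsP; apply: contraNT S'S => /fintype.existsPn S'S; apply/eqP/setP => j.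
by apply/eqP; rewrite -[_ == _]negbK.
Qed.

Lemma multilinear_deriv i h y : multilinear (set_deriv h i) y =
  \sum_(S : {set T} | i \notin S) law_but y i S * (h (i |: S) - h S).
Proof.
rewrite (multilinear_condition i); apply: eq_bigr => S iS; congr (_ * _).
rewrite /set_deriv setUA setUid setU1K//.
have -> : S :\ i = S by apply/setDidPl; rewrite disjoint_sym disjoints1.
ring.
Qed.

Lemma multilinear_raise1 h y t i : multilinear h (raise y t [:: i]) =
  multilinear h y + t * multilinear (set_deriv h i) y.
Proof.
rewrite multilinear_deriv !(multilinear_condition i) mulr_sumr -big_split /=.
apply: eq_bigr => S iS.
have -> : law_but (raise y t [:: i]) i S = law_but y i S.
  by apply: eq_bigr => j ji; rewrite /raise inE (negbTE ji) mulr0 addr0.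
rewrite /raise inE eqxx [true%:R]/(1%:R) mulr1; ring.
Qed.

(** Adding i changes nothing when i is already drawn, hence the factor 1 - y i. *)
Lemma exp_marginalE f y i :
  exp_marginal f y i = (1 - y i) * multilinear (set_deriv f i) y.
Proof.
rewrite multilinear_deriv [LHS](multilinear_condition i (fun S => f (i |: S) - f S)).
rewrite mulr_sumr; apply: eq_bigr => S iS.
rewrite setUA setUid; ring.
Qed.

Lemma raise_cons y t i s : i \notin s ->
  raise y t (i :: s) =1 raise (raise y t s) t [:: i].
Proof.
move=> iS j; rewrite /raise !inE; case: eqVneq => [->|] /=.
  by rewrite (negbTE iS) !mulr0 addr0.
by rewrite mulr0 addr0.
Qed.

Lemma in_cube_raise_sub y t s s' : in_cube y -> in_cube (raise y t s) ->
  {subset s' <= s} -> in_cube (raise y t s').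
Proof.
move=> cy cys s's k; move: (cy k) (cys k); rewrite /raise.
have [/s's ->//|_] := boolP (k \in s'); by rewrite mulr0 addr0.
Qed.

Lemma multilinear_raise_ge h y t s (m : R) : 0 <= t -> uniq s ->
  in_cube y -> in_cube (raise y t s) ->
  (forall i S, i \in s -> - m <= set_deriv h i S) ->
  multilinear h y - t * (size s)%:R * m <= multilinear h (raise y t s).
Proof.
move=> t0; elim: s => [|i s IH] /= us cy cys hm.
  by rewrite mulr0 mul0r subr0 (@eq_multilinear _ (raise y t [::]) y) // => k;
     rewrite /raise mulr0 addr0.
case/andP: us => iS us.
have cys' : in_cube (raise y t s).
  by apply: in_cube_raise_sub cy cys _ => // k ks; rewrite inE ks orbT.
rewrite (eq_multilinear _ (raise_cons y t iS)) multilinear_raise1.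
have := IH us cy cys' (fun j S js => hm j S (@mem_behead _ (i :: s) j js)).
have : - m <= multilinear (set_deriv h i) (raise y t s).
  rewrite -[- m](multilinear_cst _ (raise y t s)); apply: ler_multilinear => // S.
  by apply: hm; rewrite mem_head.
move=> /(ler_wpM2l t0); rewrite -natr1; lra.
Qed.

(** Raising the coordinates one after the other, the derivative met at each of
them differs from the one at y by at most t m per coordinate already raised;
summing over pairs gives the binomial coefficient. *)
Lemma multilinear_raise_second_order f y t s (m : R) : 0 <= t -> uniq s ->
  in_cube y -> in_cube (raise y t s) ->
  (forall i j S, i \in s -> j \in s -> i != j ->
     - m <= set_deriv (set_deriv f i) j S <= 0) ->
  let first_order :=
    multilinear f y + t * \sum_(i <- s) multilinear (set_deriv f i) y in
  first_order - t ^+ 2 * m * 'C(size s, 2)%:R <= multilinear f (raise y t s)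
    <= first_order.
Proof.
move=> t0; elim: s => [|i s IH] us cy cys fm /=.
  rewrite big_nil !mulr0 addr0 subr0 (@eq_multilinear _ (raise y t [::]) y) ?lexx// => k.
  by rewrite /raise mulr0 addr0.
case/andP: us => iS us.
have ss : {subset s <= i :: s} by move=> k ks; rewrite inE ks orbT.
have cys' : in_cube (raise y t s) by apply: in_cube_raise_sub cy cys _.
have {}IH := IH us cy cys' (fun j k S js ks => fm j k S (ss _ js) (ss _ ks)).
rewrite (eq_multilinear _ (raise_cons y t iS)) multilinear_raise1 big_cons.
have fi j S : j \in s -> - m <= set_deriv (set_deriv f i) j S <= 0.
  move=> js; apply: fm; rewrite ?mem_head ?ss//.
  by apply: contraNneq iS => ->.
have lo : multilinear (set_deriv f i) y - t * (size s)%:R * m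
    <= multilinear (set_deriv f i) (raise y t s).
  by apply: multilinear_raise_ge => // j S /(fi j S) /andP[].
have hi : multilinear (set_deriv f i) (raise y t s) <= multilinear (set_deriv f i) y.
  have := @multilinear_raise_ge (fun S => - set_deriv f i S) y t s 0 t0 us cy cys'.
  have E z : multilinear (fun S => - set_deriv f i S) z = - multilinear (set_deriv f i) z.
    by rewrite /multilinear -sumrN; apply: eq_bigr => S _; rewrite mulrN.
  rewrite !E mulr0 subr0 lerN2; apply=> j S /(fi j S) /andP[_].
  rewrite /set_deriv; lra.
move: IH => /= /andP[IH1 IH2].
move: lo hi => /(ler_wpM2l t0) lo /(ler_wpM2l t0) hi.
rewrite binS bin1 natrD; apply/andP; split; lra.
Qed.

End Multilinear.

Section SubmodularDerivatives.
Variables (R : realType) (T : finType) (f : {set T} -> R).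
Hypotheses (mono_f : monotone_fun f) (sub_f : submodular f).
Implicit Types (S O : {set T}).

Lemma set_deriv_ge0 i S : 0 <= set_deriv f i S.
Proof.
rewrite subr_ge0; apply: mono_f.
exact: fintype.subset_trans (subD1set _ _) (subsetUr _ _).
Qed.

Lemma set_deriv_le1 i S : set_deriv f i S <= f [set i]%SET - f set0.
Proof.
have := sub_f [set i]%SET (S :\ i).
have -> : [set i]%SET :|: (S :\ i) = i |: S by apply/setP => k; rewrite !inE; case: eqP.
have -> : [set i]%SET :&: (S :\ i) = set0 by apply/setP => k; rewrite !inE; case: eqP.
rewrite /set_deriv; lra.
Qed.

Lemma set_deriv2_le0 i j S : i != j -> set_deriv (set_deriv f i) j S <= 0.
Proof.
move=> ij; rewrite /set_deriv.
have := sub_f (i |: (S :\ j)) ((j |: S) :\ i).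
have -> : (i |: (S :\ j)) :|: ((j |: S) :\ i) = i |: (j |: S).
  by apply/setP => k; rewrite !inE; case: eqP => // _;
    case: eqP => //= _; case: (k \in S).
have -> : (i |: (S :\ j)) :&: ((j |: S) :\ i) = (S :\ j) :\ i.
  apply/setP => k; rewrite !inE; case: eqP => //= _; case: eqP => //= _.
  by case: (k \in S).
lra.
Qed.

(** A second derivative is a difference of two first derivatives, which lie
between 0 and the value of a singleton. *)
Lemma set_deriv2_ge i j S :
  - (f [set i]%SET - f set0) <= set_deriv (set_deriv f i) j S.
Proof.
rewrite {1}/set_deriv.
have := set_deriv_ge0 i (j |: S); have := set_deriv_le1 i (S :\ j); lra.
Qed.

(** The marginals of the elements of O, added one at a time to S, only decrease. *)
Lemma submodular_union_le S O :
  f (O :|: S) <= f S + \sum_(j <- enum O) (f (j |: S) - f S).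
Proof.
have {1}-> : O = [set:: enum O]%SET by apply/setP => k; rewrite inE mem_enum.
elim: (enum O) => [|j s IH].
  by rewrite big_nil addr0 set_nil set0U.
rewrite big_cons set_cons.
have := sub_f ([set:: s]%SET :|: S) (j |: S).
have -> : ([set:: s]%SET :|: S) :|: (j |: S) = (j |: [set:: s]%SET) :|: S.
  by apply/setP => k; rewrite !inE; case: (k == j); case: (k \in s); case: (k \in S).
have : f S <= f (([set:: s]%SET :|: S) :&: (j |: S)).
  by apply: mono_f; rewrite subsetI !subsetUr.
lra.
Qed.

End SubmodularDerivatives.

(** * Absorbing the error terms *)

Section ExponentialBounds.
Variable R : realType.

(** From e >= (1 + 1/6)^6. *)
Lemma inv_expR1_le : (expR 1)^-1 <= 4 / 10 :> R.
Proof.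
have : (1 + 6%:R^-1) ^+ 6 <= expR 1 :> R.
  rewrite -[X in expR X](@mulfV _ 6%:R) ?pnatr_eq0// expRM_natl.
  by apply: lerXn2r; rewrite ?nnegrE ?expR_ge0 ?expR_ge1Dx// addr_ge0.
move=> e_ge; have e_ge' : 10 / 4 <= expR 1 :> R by apply: le_trans e_ge; lra.
by rewrite -[4 / 10]invf_div lef_pV2// posrE ?expR_gt0.
Qed.

Lemma one_minus_inv_exp K : (64 <= K)%N ->
  3%:R^-1 <= (1 - K%:R^-1 : R) ^+ K <= (expR 1)^-1.
Proof.
move=> K64; set dl : R := K%:R^-1.
have K0 : 0 < K%:R :> R by rewrite ltr0n; apply: leq_trans K64.
have Kdl : K%:R * dl = 1 by rewrite mulfV// gt_eqF.
have dl0 : 0 < dl by rewrite invr_gt0.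
have dls : dl <= 64%:R^-1 by rewrite lef_pV2 ?posrE// ler_nat.
apply/andP; split; last first.
  rewrite -expRN -[X in expR (- X)]Kdl -mulrN expRM_natl.
  by apply: lerXn2r; rewrite ?nnegrE ?expR_ge0 ?expR_ge1Dx//; lra.
have q0 : 0 < 1 - dl by lra.
have : expR (- (dl / (1 - dl))) <= 1 - dl.
  rewrite expRN -[leRHS]invrK lef_pV2 ?posrE ?expR_gt0 ?invr_gt0//.
  (* The inverse of 1 - dl is 1 + dl / (1 - dl), hence at most expR (dl / (1 - dl)). *)
  have {1}-> : (1 - dl)^-1 = 1 + dl / (1 - dl) by field; rewrite gt_eqF.
  exact: expR_ge1Dx.
move=> /(lerXn2r K); rewrite ?nnegrE ?expR_ge0 ?(ltW q0)//.
move=> /(_ isT isT); apply: le_trans.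
rewrite -expRM_natl mulrN mulrA Kdl mul1r.
have : (1 - 8 / 63) ^+ 8 <= expR (- (64 / 63)) :> R.
  rewrite (_ : - (64 / 63) = 8%:R * (- (8 / 63))); last by lra.
  by rewrite expRM_natl; apply: lerXn2r; rewrite ?nnegrE ?expR_ge0 ?expR_ge1Dx//; lra.
have : expR (- (64 / 63)) <= expR (- (1 - dl)^-1) :> R.
  by rewrite ler_expR lerN2 -[64 / 63]invf_div lef_pV2 ?posrE//; lra.
lra.
Qed.

End ExponentialBounds.

(** The numerical core of the analysis, normalised so that the optimum is 1.
Think of F k as the value of the extension after k steps, of g k j as the
expected marginal of j and of h k j as the partial derivative.  The identity
between g and h is g = (1 - y) h. *)
Section ErrorAnalysis.
Variables (R : realType) (T : finType) (K rk : nat).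
Variables (B : nat -> {set T}) (y g h : nat -> T -> R) (F : nat -> R).
Let n := #|T|.
Let delta : R := K%:R^-1.

Hypotheses (n_gt0 : (0 < n)%N) (rk_gt0 : (0 < rk)%N).
Hypothesis K_large : (64 * n * rk ^ 2 <= K)%N.
Hypothesis y0 : forall j, y 0 j = 0.
Hypothesis yS : forall k j, y k.+1 j = y k j + delta * (j \in B k)%:R.
Hypothesis g01 : forall k j, (k < K)%N -> j \in B k -> 0 <= g k j <= 1.
Hypothesis h_ge0 : forall k j, (k < K)%N -> 0 <= h k j.
Hypothesis hE : forall k j, h k j = g k j + y k j * h k j.
Hypothesis F0 : F 0 = 0.
Hypothesis F_step : forall k, (k < K)%N ->
  let gain := delta * \sum_(j in B k) h k j in
  F k + gain - delta ^+ 2 * 'C(rk, 2)%:R <= F k.+1 <= F k + gain.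
Hypothesis g_greedy : forall k, (k < K)%N ->
  1 - F k - 2 * rk%:R * delta <= \sum_(j in B k) g k j.

(** As h = g + y * h, these two sums split the gain that the first k steps draw
from j; the second one is the surplus of partial derivatives over marginals. *)
Let received k j := \sum_(l < k) delta * (j \in B l)%:R * g l j.
Let bonus k j := \sum_(l < k) delta * (j \in B l)%:R * (y l j * h l j).
Let total_bonus k := \sum_j bonus k j.

Let delta_gt0 : 0 < delta.
Proof.
rewrite invr_gt0 ltr0n; apply: leq_trans K_large.
by rewrite !muln_gt0 n_gt0 ?expn_gt0 rk_gt0.
Qed.

Let delta_small : 64 * n%:R * rk%:R ^+ 2 * delta <= 1.
Proof.
have K0 : 0 < K%:R :> R by rewrite -invr_gt0.
by rewrite ler_pdivrMr// mul1r -natrX -!natrM ler_nat.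
Qed.

Let rk_ge1 : 1 <= rk%:R :> R. Proof. by rewrite ler1n. Qed.
Let n_ge1 : 1 <= n%:R :> R. Proof. by rewrite ler1n. Qed.

Let y_ge0 k j : 0 <= y k j.
Proof.
elim: k => [|k IH]; first by rewrite y0.
by rewrite yS addr_ge0// mulr_ge0// ltW.
Qed.

(** As g is at most 1, the coordinate y l j is at least the gain received so far,
so the surplus dominates the Riemann sum of the integral of A dA; the term in
delta is the discretisation error. *)
Lemma received_bonus k j : (k <= K)%N ->
  [/\ 0 <= received k j, received k j <= y k j
    & received k j ^+ 2 - delta * received k j <= 2 * bonus k j].
Proof.
elim: k => [_|k IH kK].
  by rewrite /received /bonus !big_ord0 y0; split=> //; rewrite !mulr0 expr0n subr0.
have [A0 Ay Ab] := IH (ltnW kK).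
rewrite /received /bonus !big_ord_recr /= -/(received k j) -/(bonus k j) yS.
have [jB|_] := boolP (j \in B k); last by rewrite !(mulr0, mul0r) !addr0.
rewrite [true%:R]/(1%:R) !mulr1.
have /andP[g0 g1] := g01 kK jB.
have gh : g k j <= h k j by rewrite hE lerDl mulr_ge0// h_ge0.
split; first by rewrite addr_ge0// mulr_ge0// ltW.
  by rewrite lerD// ler_piMr// ltW.
have yg : received k j * g k j <= y k j * h k j by apply: ler_pM.
have : delta * (received k j * g k j) <= delta * (y k j * h k j).
  by rewrite ler_pM2l.
have : delta ^+ 2 * (g k j * (1 - g k j)) >= 0.
  by rewrite mulr_ge0// ?sqr_ge0// mulr_ge0// subr_ge0.
lra.
Qed.

Let total_received k := \sum_j received k j.

Let sum_setE (A : {set T}) (x : T -> R) : \sum_(j in A) x j = \sum_j (j \in A)%:R * x j.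
Proof.
rewrite big_mkcond; apply: eq_bigr => j _.
by case: (j \in A); rewrite ?mul1r ?mul0r.
Qed.

Let total_receivedS k :
  total_received k.+1 = total_received k + delta * \sum_(j in B k) g k j.
Proof.
rewrite sum_setE mulr_sumr -big_split; apply: eq_bigr => j _.
by rewrite /received big_ord_recr /= -mulrA.
Qed.

Let total_bonusS k :
  total_bonus k.+1 = total_bonus k + delta * \sum_(j in B k) y k j * h k j.
Proof.
rewrite sum_setE mulr_sumr -big_split; apply: eq_bigr => j _.
by rewrite /bonus big_ord_recr /= -mulrA.
Qed.

Let total0 : (total_received 0 = 0) * (total_bonus 0 = 0).
Proof.
by split; apply: big1 => j _; rewrite /received /bonus big_ord0.
Qed.

Let sum_h k : \sum_(j in B k) h k j =
  \sum_(j in B k) g k j + \sum_(j in B k) y k j * h k j.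
Proof. by rewrite -big_split; apply: eq_bigr => j _; rewrite /= -hE. Qed.

Let bonus_step_ge0 k : (k < K)%N -> 0 <= \sum_(j in B k) y k j * h k j.
Proof. by move=> kK; apply: sumr_ge0 => j _; rewrite mulr_ge0// h_ge0. Qed.

Lemma value_le_total k : (k <= K)%N -> F k <= total_received k + total_bonus k.
Proof.
elim: k => [_|k IH kK]; first by rewrite F0 !total0 addr0.
have := IH (ltnW kK); have /andP[_] := F_step kK.
rewrite total_receivedS total_bonusS sum_h mulrDr; lra.
Qed.

Let eps := 2 * rk%:R ^+ 2 * delta ^+ 2.

(** The first term comes from the inaccurate weights, the second from the
second-order expansion. *)
Let eps_step : 2 * rk%:R * delta ^+ 2 + delta ^+ 2 * 'C(rk, 2)%:R <= eps.
Proof.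
have -> : 'C(rk, 2)%:R = rk%:R * (rk%:R - 1) / 2 :> R.
  have /(congr1 (fun m => m%:R : R)) : ('C(rk, 2) * 2 = rk * rk.-1)%N.
    by rewrite -[2%N]/(2`!) bin_ffact ffactnS ffactn1.
  rewrite !natrM => E.
  have -> : rk%:R - 1 = rk.-1%:R :> R by rewrite -{1}(prednK rk_gt0) -natr1 addrK.
  by rewrite -E mulfK// pnatr_eq0.
have : 0 <= delta ^+ 2 * (rk%:R * (rk%:R - 1)).
  by rewrite mulr_ge0 ?sqr_ge0// mulr_ge0// subr_ge0.
rewrite /eps; lra.
Qed.

(** The recursion contracts the gap by 1 - delta at each step; the surplus of a
step is contracted by the later steps only, but charging it with the whole
power (1 - delta) ^+ k keeps the bound in closed form. *)
Lemma gap_le k : (k <= K)%N ->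
  1 - F k <= (1 - delta) ^+ k * (1 - total_bonus k) + k%:R * eps.
Proof.
have d1 : delta <= 1.
  apply: le_trans delta_small; rewrite ler_peMl ?(ltW delta_gt0)//.
  by rewrite -natrX -!natrM ler1n !muln_gt0 n_gt0 ?expn_gt0 rk_gt0.
have q0 m : 0 <= (1 - delta) ^+ m <= 1.
  by rewrite exprn_ge0 ?exprn_ile1 ?subr_ge0 ?gerBl ?(ltW delta_gt0).
elim: k => [_|k IH kK].
  by rewrite F0 total0 !subr0 expr0 !mul1r mul0r addr0.
have {IH} := IH (ltnW kK); have /andP[+ _] := F_step kK.
have := g_greedy kK; rewrite sum_h total_bonusS => /(ler_wpM2l (ltW delta_gt0)).
set G := \sum_(j in B k) g k j; have := bonus_step_ge0 kK.
set Y := \sum_(j in B k) _ => Y0 hG hF.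
have /andP[qk0 qk1] := q0 k.+1.
have q1 : 0 <= 1 - delta by rewrite subr_ge0.
move=> /(ler_wpM2l q1); rewrite [leRHS]mulrDr [_ * (_ ^+ k * _)]mulrA -exprS.
have eps0 : 0 <= k%:R * eps by rewrite mulr_ge0// !mulr_ge0// ltW.
have := mulr_ge0 (ltW delta_gt0) eps0.
have dY : 0 <= delta * Y by rewrite mulr_ge0// ltW.
have := ler_piMl dY qk1.
move: eps_step; rewrite -[k.+1%:R]natr1; lra.
Qed.

(** The inequality A ^+ 2 >= 2 * A * t - t ^+ 2 linearises the sum of squares;
t = 1 / (2 n) is the value taken by each A when they are equal and add up to
1 / 2, close to the bound on their sum used below. *)
Lemma total_bonus_ge : n%:R^-1 *
  (total_received K * (1 - n%:R * delta) - 4%:R^-1) <= 2 * total_bonus K.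
Proof.
have n0 : n%:R != 0 :> R by rewrite pnatr_eq0 -lt0n.
have -> : n%:R^-1 * (total_received K * (1 - n%:R * delta) - 4%:R^-1) =
    \sum_j (n%:R^-1 * received K j - (4%:R^-1 * n%:R^-2) - delta * received K j).
  rewrite !sumrB -!mulr_sumr -/(total_received K) sumr_const -/n -mulr_natr; field.
  by [].
rewrite mulr_sumr; apply: ler_sum => j _.
have [_ _] := received_bonus j (leqnn K).
have := sqr_ge0 (received K j - (2 * n%:R)^-1).
rewrite sqrrB invfM exprMn exprVn; lra.
Qed.

Theorem error_terms_absorbed : 1 - (expR 1)^-1 <= F K.
Proof.
have K64 : (64 <= K)%N.
  by apply: leq_trans K_large; rewrite -mulnA leq_pmulr// muln_gt0 n_gt0 ?expn_gt0 rk_gt0.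
have /andP[q_ge q_le] := one_minus_inv_exp R K64.
have e4 := inv_expR1_le R.
have Kd : K%:R * delta = 1 by rewrite mulfV// -invr_eq0 gt_eqF.
have n0 : 0 < n%:R :> R by rewrite ltr0n.
set v : R := n%:R^-1; have v0 : 0 < v by rewrite invr_gt0.
have nv : n%:R * v = 1 by rewrite mulfV// gt_eqF.
have v1 : v <= 1 by rewrite invf_le1.
have Keps : K%:R * eps <= v / 32.
  have -> : K%:R * eps = 2 * rk%:R ^+ 2 * delta * (K%:R * delta) by rewrite /eps; ring.
  rewrite Kd mulr1; have := ler_wpM2r (ltW v0) delta_small.
  have -> : 64 * n%:R * rk%:R ^+ 2 * delta * v =
      64 * rk%:R ^+ 2 * delta * (n%:R * v) by ring.
  rewrite nv; lra.
have U0 : 0 <= total_bonus K.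
  apply: sumr_ge0 => j _; apply: sumr_ge0 => l _.
  by rewrite mulr_ge0 ?(mulr_ge0 (ltW delta_gt0)) ?mulr_ge0 ?h_ge0.
have c0 : 0 <= total_received K.
  by apply: sumr_ge0 => j _; have [] := received_bonus j (leqnn K).
have nd : n%:R * delta <= 64%:R^-1.
  have : n%:R * delta * 1 <= n%:R * delta * rk%:R ^+ 2.
    by rewrite ler_wpM2l ?mulr_ge0 ?expr_ge1// ltW.
  move: delta_small; lra.
have qU : 3%:R^-1 * total_bonus K <= (1 - delta) ^+ K * total_bonus K.
  by rewrite ler_wpM2r.
have gap := gap_le (leqnn K).
(* A third of this surplus equals the error v / 32. *)
suff : 3 / 32 * v <= total_bonus K by lra.
rewrite leNgt; apply/negP => Uv.
have value := value_le_total (leqnn K).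
(* 475 / 1000 = 6 / 10 - 1 / 32 - 3 / 32: by gap, F K is at least 6 / 10 minus the
   error, and the surplus is assumed to be below 3 / 32. *)
have c_ge : 475 / 1000 <= total_received K by lra.
have /(ler_wpM2l c0) : 1 - 64%:R^-1 <= 1 - n%:R * delta by lra.
move=> c_ge'.
have : v * (2 / 10) <= v * (total_received K * (1 - n%:R * delta) - 4%:R^-1).
  by rewrite ler_pM2l//; lra.
have := total_bonus_ge; rewrite -/v; lra.
Qed.

End ErrorAnalysis.

(** * Continuous greedy over a matroid *)

Section Bases.
Variables (T : finType) (indep : pred {set T}).
Hypothesis matroid_indep : is_matroid indep.
Implicit Types (S A B : {set T}).

Lemma indep_card_le_rank S A : indep S -> S \subset A ->
  (#|S| <= matroid_rank indep A)%N.
Proof.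
move=> iS SA; apply: (leq_bigmax_cond (F := fun S : {set T} => #|S|)).
by rewrite iS SA.
Qed.

(** Augment S from a largest independent set M until its size is the rank. *)
Lemma indep_extends S : indep S -> exists2 B, is_base indep B & S \subset B.
Proof.
have [i0 _ aug] := matroid_indep.
have [M /andP[iM _] rM] : {M : {set T} | indep M && (M \subset setT)
    & matroid_rank indep setT = #|M|}.
  apply: eq_bigmax_cond; apply/card_gt0P; exists set0.
  by rewrite unfold_in /= i0 subsetT.
have [m] := ubnP (#|M| - #|S|); elim: m S => // m IH S mS iS.
have [MS|SM] := leqP #|M| #|S|.
  exists S => //; rewrite /is_base iS eqn_leq rM MS andbT -rM.
  by rewrite indep_card_le_rank// subsetT.
have [x /setDP[_ xS] ixS] := aug _ _ iS iM SM.
have [|//|B bB SB] := IH (x |: S).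
  by rewrite cardsU1 xS; move: mS SM; lia.
by exists B => //; apply: fintype.subset_trans SB; apply: subsetUr.
Qed.

Lemma max_weight_baseP (R : realType) (w : T -> R) :
  is_max_weight_base indep w (max_weight_base indep w).
Proof.
rewrite /max_weight_base; case: pickP => //= none.
have [i0 _ _] := matroid_indep.
have [B0 bB0 _] := indep_extends i0.
have [B bB Bmax] := @arg_maxP _ _ _ _ _ (fun B : {set T} => \sum_(j in B) w j) bB0.
have /negP[] := negbT (none B); rewrite /is_max_weight_base bB.
by apply/forallP => B'; apply/implyP => /Bmax.
Qed.

End Bases.

Section ContinuousGreedy.
Variables (R : realType) (T : finType) (f : {set T} -> R) (indep : pred {set T}).
Variables (K : nat) (w : nat -> T -> R).
Hypotheses (mono_f : monotone_fun f) (sub_f : submodular f).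
Hypothesis f0 : f set0 = 0.
Hypothesis matroid_indep : is_matroid indep.
Hypothesis steps : enough_steps indep K.
Hypothesis accurate : accurate_weights f indep K w.
Let y := continuous_greedy indep K w.
Let B k := max_weight_base indep (w k).
Let rk := matroid_rank indep [set: T].
Let o := opt f indep.

Let f_ge0 S : 0 <= f S.
Proof. by rewrite -f0; apply: mono_f; apply: sub0set. Qed.

Lemma indep_le_opt S : indep S -> f S <= o.
Proof. by move=> iS; apply: le_bigmax_cond. Qed.

Let base_B k : is_base indep (B k).
Proof. by have /andP[] := max_weight_baseP matroid_indep (w k). Qed.

Let card_B k : #|B k| = rk.
Proof. by have /andP[_ /eqP] := base_B k. Qed.

Let K_gt0 : (0 < K)%N. Proof. by case: steps. Qed.

Lemma continuous_greedy_bounds k j : (k <= K)%N -> 0 <= y k j <= k%:R / K%:R.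
Proof.
have K0 : 0 <= K%:R^-1 :> R by rewrite invr_ge0.
elim: k => [_|k IH kK]; first by rewrite /y /= mul0r lexx.
have {IH}/andP[y0 y1] := IH (ltnW kK).
have -> : y k.+1 j = y k j + K%:R^-1 * (j \in B k)%:R by [].
rewrite -natr1 mulrDl mul1r.
by case: (j \in B k); rewrite ?mulr1 ?mulr0; apply/andP; split; lra.
Qed.

Lemma continuous_greedy_in_cube k : (k <= K)%N -> in_cube (y k).
Proof.
move=> kK j; have /andP[-> /le_trans] := continuous_greedy_bounds j kK.
by apply; rewrite ler_pdivrMr ?ltr0n// mul1r ler_nat.
Qed.

Let opt_singleton k j : j \in B k -> f [set j]%SET <= o.
Proof.
move=> jB; apply: indep_le_opt; have [_ down _] := matroid_indep.
apply: (down _ (B k)); first by rewrite sub1set.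
by case/andP: (base_B k).
Qed.

Let marginal_le k j : (k < K)%N -> j \in B k -> exp_marginal f (y k) j <= o.
Proof.
move=> kK jB; apply: le_trans (opt_singleton jB).
rewrite -[leRHS](multilinear_cst _ (y k)); apply: ler_multilinear => [|S].
  exact: continuous_greedy_in_cube (ltnW kK).
have := set_deriv_le1 sub_f j S; rewrite f0 subr0 /set_deriv.
have : f (S :\ j) <= f S by apply: mono_f; apply: subD1set.
lra.
Qed.

(** Adding to the random set a base that contains an optimal solution reaches the
optimum, so the marginals over that base cover the gap.  The selected base does
as well up to the estimation error of the weights, paid once on each of the two
bases. *)
Lemma opt_gap_le_base_marginals k : (k < K)%N ->
  o - multilinear f (y k) - 2 * rk%:R * K%:R^-1 * o
    <= \sum_(j in B k) exp_marginal f (y k) j.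
Proof.
move=> kK; set d : R := K%:R^-1.
have cy := continuous_greedy_in_cube (ltnW kK).
suff main S : indep S -> f S <= multilinear f (y k) + 2 * rk%:R * d * o +
    \sum_(j in B k) exp_marginal f (y k) j.
  suff : o <= multilinear f (y k) + 2 * rk%:R * d * o +
    \sum_(j in B k) exp_marginal f (y k) j by lra.
  by apply: bigmax_le => [|S /main//]; apply: main; case: matroid_indep.
move=> iS; have [C bC SC] := indep_extends matroid_indep iS.
have cC : #|C| = rk by case/andP: bC => _ /eqP.
apply: le_trans (mono_f SC) _.
have fC : f C <= multilinear f (y k) + \sum_(j in C) exp_marginal f (y k) j.
  rewrite -[\sum_(j in C) _]big_enum /= -multilinear_sum -multilinearD.
  rewrite -[leLHS](multilinear_cst _ (y k)); apply: ler_multilinear => // A.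
  apply: le_trans (submodular_union_le mono_f sub_f _ _).
  by apply: mono_f; apply: subsetUl.
have /andP[_ /forallP/(_ C)] := max_weight_baseP matroid_indep (w k).
rewrite bC /= -/(B k) => wCB.
have wC : \sum_(j in C) exp_marginal f (y k) j <= \sum_(j in C) w k j + rk%:R * (d * o).
  rewrite -cC mulr_natl -sumr_const -big_split; apply: ler_sum => j _ /=.
  by have := accurate j kK; rewrite -/(y k) -/o -/d ler_norml; lra.
have wB : \sum_(j in B k) w k j <=
    \sum_(j in B k) exp_marginal f (y k) j + rk%:R * (d * o).
  rewrite -(card_B k) mulr_natl -sumr_const -big_split; apply: ler_sum => j _ /=.
  by have := accurate j kK; rewrite -/(y k) -/o -/d ler_norml; lra.
lra.
Qed.

Lemma continuous_greedy_step k : (k < K)%N ->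
  let gain := K%:R^-1 * \sum_(j in B k) multilinear (set_deriv f j) (y k) in
  multilinear f (y k) + gain - K%:R^-1 ^+ 2 * 'C(rk, 2)%:R * o
    <= multilinear f (y k.+1) <= multilinear f (y k) + gain.
Proof.
move=> kK; set d : R := K%:R^-1; rewrite /=.
have ys : y k.+1 =1 raise (y k) d (enum (B k)).
  by move=> j; rewrite /raise mem_enum.
have c1 : in_cube (raise (y k) d (enum (B k))).
  by move=> j; rewrite -ys; apply: continuous_greedy_in_cube.
have d0 : 0 <= d by rewrite invr_ge0.
have := multilinear_raise_second_order d0 (enum_uniq _)
  (continuous_greedy_in_cube (ltnW kK)) c1.
move=> /(_ f o) /= H; rewrite (eq_multilinear _ ys).
rewrite -big_enum -(card_B k) cardE mulrAC; apply: H => i j S.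
rewrite !mem_enum => iB jB ij; rewrite set_deriv2_le0// andbT.
apply: le_trans (set_deriv2_ge mono_f sub_f i j S).
by rewrite lerN2 f0 subr0; exact: opt_singleton iB.
Qed.

(** The normalised analysis, applied to all quantities divided by the optimum. *)
Theorem continuous_greedy_approx :
  (1 - (expR 1)^-1) * o <= multilinear f (y K).
Proof.
have cK := continuous_greedy_in_cube (leqnn K).
have F_ge0 : 0 <= multilinear f (y K).
  by rewrite -(multilinear_cst 0 (y K)); apply: ler_multilinear.
have [opt_le0|opt_gt0] := lerP o 0.
  apply: le_trans F_ge0; rewrite mulr_ge0_le0// subr_ge0.
  have := inv_expR1_le R; lra.
have rk_gt0 : (0 < rk)%N.
  rewrite lt0n; apply: contraTneq opt_gt0 => rk0; rewrite -leNgt.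
  apply: bigmax_le => [|S iS]; first by rewrite f0.
  have := indep_card_le_rank iS (subsetT S).
  by rewrite -/rk rk0 leqn0 cards_eq0 => /eqP->; rewrite f0.
have n_gt0 : (0 < #|T|)%N.
  by apply: leq_trans rk_gt0 _; rewrite -(card_B 0) max_card.
rewrite -ler_pdivlMr//.
pose G k j := exp_marginal f (y k) j / o.
pose H k j := multilinear (set_deriv f j) (y k) / o.
have h_ge0 k j : (k < K)%N -> 0 <= multilinear (set_deriv f j) (y k).
  move=> kK; rewrite -(multilinear_cst 0 (y k)); apply: ler_multilinear => [|S].
    exact: continuous_greedy_in_cube (ltnW kK).
  exact: set_deriv_ge0.
apply: (@error_terms_absorbed _ _ K rk B y G H (fun k => multilinear f (y k) / o)) => //.
- by case: steps.
- move=> k j kK jB; rewrite /G ler_pdivrMr// mul1r marginal_le// andbT.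
  rewrite divr_ge0 ?(ltW opt_gt0)//.
  rewrite exp_marginalE mulr_ge0 ?h_ge0// subr_ge0.
  by case/andP: (continuous_greedy_in_cube (ltnW kK) j).
- by move=> k j kK; rewrite divr_ge0 ?h_ge0 ?(ltW opt_gt0).
- by move=> k j; rewrite /G /H exp_marginalE; ring.
- suff -> : multilinear f (y 0) = f set0 by rewrite f0 mul0r.
  rewrite -(multilinear_indicator f set0); apply: eq_multilinear => j.
  by rewrite inE.
- move=> k kK; have := continuous_greedy_step kK.
  set gain := _ * _ => /= /andP[lo hi].
  rewrite /H -mulr_suml mulrA -/gain -mulrDl.
  rewrite ler_pM2r ?invr_gt0// hi andbT.
  by rewrite ler_pdivlMr// mulrBl mulfVK ?gt_eqF.
- move=> k kK; rewrite /G -mulr_suml ler_pdivlMr// !mulrBl mul1r mulfVK ?gt_eqF//.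
  exact: opt_gap_le_base_marginals.
Qed.

End ContinuousGreedy.

(** * Partition matroids with unit capacities *)

Definition one_per_class (T I : finType) (cls : T -> I) (S : {set T}) : bool :=
  [forall i : I, #|[set e in S | cls e == i]| <= 1]%N.

Section OnePerClass.
Variables (T I : finType) (cls : T -> I).
Implicit Types S A B : {set T}.
Local Notation indep := (one_per_class cls).

Lemma one_per_classP S : reflect {in S &, injective cls} (indep S).
Proof.
apply: (iffP fintype.forallP) => [le1 x x' xS x'S xx'|inj i].
  by apply: (card_le1_eqP (le1 (cls x))); rewrite inE ?xS ?x'S ?xx' eqxx.
apply/card_le1_eqP => x x'; rewrite !inE => /andP[xS /eqP xi] /andP[x'S /eqP x'i].
by apply: inj; rewrite // xi.
Qed.

Lemma one_per_class_rank A : matroid_rank indep A = #|cls @: A|.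
Proof.
apply/eqP; rewrite eqn_leq; apply/andP; split.
  apply/bigmax_leqP => S /andP[/one_per_classP iS SA].
  by rewrite -(card_in_imset iS) subset_leq_card// imsetS.
(* One representative in A of each class that A meets. *)
pose rep c := [pick z in A | cls z == c].
pose S := [set x in A | rep (cls x) == Some x].
have iS : {in S &, injective cls}.
  move=> x x'; rewrite !inE => /andP[_ /eqP xx] /andP[_ /eqP x'x'] xx'.
  by apply: Some_inj; rewrite -xx -x'x' xx'.
have -> : cls @: A = cls @: S.
  apply/setP => c; apply/imsetP/imsetP => -[x]; last first.
    by rewrite inE => /andP[xA _] ->; exists x.
  move=> xA ->; have [z rz] : exists z, rep (cls x) = Some z.
    rewrite /rep; case: pickP => [z _|/(_ x)]; first by exists z.
    by rewrite xA eqxx.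
  have [zA /eqP zx] : z \in A /\ cls z == cls x.
    by move: rz; rewrite /rep; case: pickP => // u /andP[uA ux] [<-].
  by exists z => //; rewrite inE zA zx rz eqxx.
rewrite (card_in_imset iS); apply: (leq_bigmax_cond (F := fun S : {set T} => #|S|)).
apply/andP; split; first exact/one_per_classP.
by apply/fintype.subsetP => x; rewrite inE => /andP[].
Qed.

Lemma one_per_class_matroid : is_matroid indep.
Proof.
split.
- by apply/one_per_classP => x x'; rewrite inE.
- move=> A B /fintype.subsetP AB /one_per_classP iB; apply/one_per_classP => x x' xA x'A.
  by apply: iB; apply: AB.
- move=> A B /one_per_classP iA /one_per_classP iB AB.
  have : ~~ (cls @: B \subset cls @: A).
    by apply: contraL AB => /subset_leq_card; rewrite !card_in_imset// leqNgt.
  case/fintype.subsetPn => _ /imsetP[x xB ->] xA.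
  exists x.
    by rewrite inE xB andbT; apply: contra xA => xA; apply: imset_f.
  apply/one_per_classP => u u'; rewrite !inE => /orP[/eqP->|uA] /orP[/eqP->|u'A] // uu'.
  + by case/negP: xA; rewrite uu' imset_f.
  + by case/negP: xA; rewrite -uu' imset_f.
  + exact: iA.
Qed.

Lemma one_per_class_partition_matroid : is_partition_matroid indep.
Proof.
split; first exact: one_per_class_matroid.
exists (preim_partition cls setT), (fun=> 1%N); split; first exact: preim_partitionP.
move=> S; apply/one_per_classP/fintype.forall_inP => [iS X|le1 x x' xS x'S xx'].
  case/imsetP => z _ ->; apply/card_le1_eqP => x x'.
  rewrite !inE /= => /andP[xS /eqP xz] /andP[x'S /eqP x'z].
  by apply: iS => //; rewrite -xz.
have := le1 [set u in setT | cls x == cls u].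
have -> : [set u in setT | cls x == cls u] \in preim_partition cls setT.
  by apply/imsetP; exists x => //; rewrite inE.
by move=> /(_ isT)/card_le1_eqP; apply; rewrite !inE ?xS ?x'S ?xx' eqxx.
Qed.

End OnePerClass.

(** * Pipage rounding *)

Section Pipage.
Variables (R : realType) (T I : finType) (cls : T -> I) (f : {set T} -> R).
Hypothesis sub_f : submodular f.
Implicit Types (y : T -> R) (i j k : T).
Local Notation indep := (one_per_class cls).

(** The base polytope of the matroid. *)
Definition class_distribution y :=
  (forall k, 0 <= y k) /\ forall i, \sum_(k | cls k == cls i) y k = 1.

Definition class_support_le1 y :=
  forall i j, i != j -> cls i = cls j -> y i = 0 \/ y j = 0.

Definition transfer y (t : R) i j : T -> R :=
  fun k => y k + t * ((k == i)%:R - (k == j)%:R).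

Lemma class_distribution_in_cube y : class_distribution y -> in_cube y.
Proof.
case=> y0 y1 k; rewrite y0 -(y1 k) (bigD1 k)//= lerDl; exact: sumr_ge0.
Qed.

Lemma sum_le_rank y (A : {set T}) : class_distribution y ->
  \sum_(k in A) y k <= (matroid_rank indep A)%:R.
Proof.
case=> y0 y1; rewrite one_per_class_rank (partition_big_imset cls) /= -sum1_card natr_sum.
apply: ler_sum => _ /imsetP[i iA ->]; rewrite -(y1 i) [leRHS]big_mkcond [leLHS]big_mkcond.
by apply: ler_sum => k _; case: (k \in A) => //=; case: ifP.
Qed.

(** A set A that contains i has the rank of j |: A, whose mass is bounded by that
rank; so the mass of j fits in every constraint, and only its exhaustion stops
the move. *)
Lemma hit_constraint_same_class y i j : class_distribution y ->
  i != j -> cls i = cls j -> hit_constraint indep y i j = y j.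
Proof.
move=> dy ij cij; apply/le_anti/andP; split; first exact: bigmin_le_id.
apply: le_bigmin => // A /andP[iA jA].
rewrite lerBrDr -big_setU1//= (_ : matroid_rank indep A = matroid_rank indep (j |: A)).
  exact: sum_le_rank.
rewrite !one_per_class_rank; congr #|pred_of_set _|.
rewrite imsetU1 -cij; apply/esym/setUidPr; rewrite sub1set imset_f//.
Qed.

(** The class of i is a tight set that separates i from j. *)
Lemma hit_constraint_other_class y i j : class_distribution y ->
  cls i != cls j -> hit_constraint indep y i j <= 0.
Proof.
move=> [y0 y1] cij; pose A := [set k | cls k == cls i].
apply: (@le_trans _ _ ((matroid_rank indep A)%:R - \sum_(k in A) y k)).
  by apply: bigmin_le_cond; rewrite !inE eqxx eq_sym.
rewrite (eq_bigl (fun k => cls k == cls i)); last by move=> k; rewrite inE.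
rewrite y1 subr_le0 lern1 one_per_class_rank -(cards1 (cls i)) subset_leq_card//.
apply/fintype.subsetP => _ /imsetP[k kA ->]; rewrite inE; by move: kA; rewrite inE.
Qed.

Lemma exchangeable_pair y i j : class_distribution y -> i != j ->
  (0 < hit_constraint indep y i j) && (0 < hit_constraint indep y j i) =
  [&& cls i == cls j, 0 < y i & 0 < y j].
Proof.
move=> dy ij; case: (eqVneq (cls i) (cls j)) => [cij|cij] /=.
  by rewrite !hit_constraint_same_class ?[j == i]eq_sym// andbC.
by rewrite ltNge hit_constraint_other_class.
Qed.

(** The quadratic term of the extension along this direction is minus the mixed
second derivative, which is nonpositive by submodularity. *)
Lemma multilinear_transfer_ge y t i j : in_cube y -> i != j ->
  multilinear f y + t * (multilinear (set_deriv f i) y - multilinear (set_deriv f j) y)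
    <= multilinear f (transfer y t i j).
Proof.
move=> cy ij.
have E : transfer y t i j =1 raise (raise y t [:: i]) (- t) [:: j].
  by move=> k; rewrite /transfer /raise !inE; ring.
rewrite (eq_multilinear _ E) !multilinear_raise1.
have : 0 <= - multilinear (set_deriv (set_deriv f j) i) y.
  rewrite oppr_ge0 -[leRHS](multilinear_cst 0 y); apply: ler_multilinear => // S.
  by apply: set_deriv2_le0; rewrite // eq_sym.
move=> /(mulr_ge0 (sqr_ge0 t)); lra.
Qed.

Lemma transfer_class_distribution y i j : class_distribution y ->
  i != j -> cls i = cls j -> class_distribution (transfer y (y j) i j).
Proof.
move=> [y0 y1] ij cij; split=> k.
  rewrite /transfer; case: (eqVneq k j) => [->|kj].
    by rewrite eq_sym (negbTE ij) sub0r mulrN mulr1 subrr.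
  by rewrite subr0 addr_ge0// mulr_ge0.
rewrite big_split /= y1 -mulr_sumr sumrB.
have E l : \sum_(m | cls m == cls k) (m == l)%:R = (cls l == cls k)%:R :> R.
  rewrite big_mkcond (bigD1 l)//= eqxx big1 ?addr0; first by case: ifP.
  by move=> m /negbTE->; case: ifP.
by rewrite !E cij subrr mulr0 addr0.
Qed.

Definition support y := [set k | y k != 0].

Lemma transfer_support y i j : i != j -> y i != 0 -> y j != 0 ->
  (#|support (transfer y (y j) i j)| < #|support y|)%N.
Proof.
move=> ij yi yj; apply: proper_card; apply/properP; split.
  apply/fintype.subsetP => k; rewrite !inE; apply: contra => /eqP yk.
  have ki : k != i by apply: contraNneq yi => <-; apply/eqP.
  have kj : k != j by apply: contraNneq yj => <-; apply/eqP.
  by rewrite /transfer yk (negbTE ki) (negbTE kj) subrr mulr0 addr0.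
exists j; rewrite !inE// negbK /transfer eqxx [j == i]eq_sym (negbTE ij).
by rewrite sub0r mulrN mulr1 subrr.
Qed.

(** The two ends of the segment are reached in opposite directions, so the
first-order change is nonnegative at one of them. *)
Lemma pipage_stepP y : class_distribution y ->
  let y' := pipage_step f indep y in
  [/\ class_distribution y', multilinear f y <= multilinear f y'
    & (class_support_le1 y /\ y' = y) \/
      (~ class_support_le1 y /\ (#|support y'| < #|support y|)%N)].
Proof.
move=> dy; rewrite /pipage_step; case: pickP => [[i j]|none] /=; last first.
  split=> //; left; split=> // i j ij cij.
  have := none (i, j); rewrite /= ij exchangeable_pair// cij eqxx /=.
  have [y0 _] := dy.
  have [/eqP->|yi] := boolP (y i == 0); first by left.
  have [/eqP->|yj] := boolP (y j == 0); first by right.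
  by rewrite !lt_def yi yj !y0.
case/andP => ij; rewrite exchangeable_pair// => /and3P[/eqP cij yi yj].
have ji : j != i by rewrite eq_sym.
have E u v : hit_constraint indep y u v = y v ->
    move_mass indep y u v = transfer y (y v) u v.
  by rewrite /move_mass => ->.
rewrite !E ?hit_constraint_same_class//.
have cy := class_distribution_in_cube dy.
have := multilinear_transfer_ge (y j) cy ij.
have := multilinear_transfer_ge (y i) cy ji.
set L := _ - _; set L' := _ - _; have -> : L = - L' by rewrite opprB.
move=> hr hl; split.
- by case: ifP => _; apply: transfer_class_distribution.
- case: (lerP 0 L') => [L0|/ltW L0].
    have := mulr_ge0 (ltW yj) L0.
    case: (lerP _ (multilinear f (transfer y (y j) i j))); lra.
  have := mulr_ge0_le0 (ltW yi) L0.
    case: (lerP _ (multilinear f (transfer y (y j) i j))); lra.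
- right; split; last by case: ifP => _; apply: transfer_support; rewrite // gt_eqF.
  by move=> /(_ _ _ ij cij)[] y0; move: yi yj; rewrite y0 ltxx.
Qed.

(** As long as mass can be exchanged, each step removes an element of the support,
so the support bounds the number of effective steps. *)
Lemma iter_pipage_stepP y m : class_distribution y ->
  let y' := iter m (pipage_step f indep) y in
  [/\ class_distribution y', multilinear f y <= multilinear f y'
    & class_support_le1 y' \/ (#|support y'| + m <= #|support y|)%N].
Proof.
move=> dy; elim: m => [|m] /=; first by split=> //; right; rewrite addn0.
set z := iter m _ y => -[dz yz sz].
have [dz' zz' sz'] := pipage_stepP dz; split=> //; first exact: le_trans zz'.
case: sz' => [[int_z ->]|[nint_z sz']]; first by left.
by case: sz => // sz; right; lia.
Qed.

Lemma class_support_indicator y : class_distribution y -> class_support_le1 y ->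
  indep [set k | y k == 1] /\ y =1 fun k => (k \in [set k | y k == 1])%:R.
Proof.
move=> [y0 y1] sy; split.
  apply/one_per_classP => i j; rewrite !inE => /eqP yi /eqP yj cij.
  apply/eqP; apply: contraT => ij; have [] := sy i j ij cij.
    by rewrite yi => /eqP; rewrite oner_eq0.
  by rewrite yj => /eqP; rewrite oner_eq0.
move=> k; rewrite inE; have [->|yk] := eqVneq (y k) 0; first by rewrite eq_sym oner_eq0.
suff -> : y k = 1 by rewrite eqxx.
rewrite -(y1 k) (bigD1 k)//= big1 ?addr0// => j /andP[/eqP ckj jk].
by have [//|/eqP] := sy j k jk ckj; rewrite (negbTE yk).
Qed.

Theorem pipage_roundP y : class_distribution y ->
  indep (pipage_round f indep y) /\ multilinear f y <= f (pipage_round f indep y).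
Proof.
move=> dy; have [] := iter_pipage_stepP #|T| dy; rewrite /pipage_round.
set z := iter _ _ y => dz yz sz.
have iz : class_support_le1 z.
  case: sz => // sz i j _ _; left; apply/eqP.
  have : #|support z| == 0%N by have := max_card (support y); lia.
  by rewrite cards_eq0 => /eqP/setP/(_ i); rewrite !inE => /negbT; rewrite negbK.
have [iS zE] := class_support_indicator dz iz; split=> //.
by apply: le_trans yz _; rewrite (eq_multilinear _ zE) multilinear_indicator.
Qed.

Lemma base_class_sum (B : {set T}) i : is_base indep B ->
  \sum_(k | cls k == cls i) (k \in B)%:R = 1 :> R.
Proof.
case/andP => /one_per_classP iB; rewrite one_per_class_rank => /eqP cB.
have : cls i \in cls @: B.
  suff -> : cls @: B = cls @: setT by rewrite imset_f.
  by apply/eqP; rewrite eqEcard imsetS ?subsetT//= -cB card_in_imset.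
case/imsetP => k kB ik; rewrite (bigD1 k) ?ik//= kB big1 ?addr0// => j /andP[/eqP cj jk].
by have [jB|//] := boolP (j \in B); case/eqP: jk; apply: iB.
Qed.

Lemma continuous_greedy_class_distribution K (w : nat -> T -> R) : (0 < K)%N ->
  class_distribution (continuous_greedy indep K w K).
Proof.
move=> K0; have Kn : K%:R != 0 :> R by rewrite pnatr_eq0 -lt0n.
have bB m : is_base indep (max_weight_base indep (w m)).
  by have /andP[] := max_weight_baseP (one_per_class_matroid cls) (w m).
split=> i.
  by elim: {2}K => [|m IH] //=; rewrite addr_ge0// mulr_ge0// invr_ge0.
have E m : \sum_(k | cls k == cls i) continuous_greedy indep K w m k = m%:R / K%:R.
  elim: m => [|m IH] /=; first by rewrite big1 ?mul0r.
  by rewrite big_split /= IH -mulr_sumr base_class_sum// mulr1 -natr1 mulrDl mul1r.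
by rewrite E mulfV.
Qed.

End Pipage.

(** * The revenue is monotone and submodular *)

Section SupermodularProducts.
Variables (R : realType) (C : finType).
Implicit Types (u v : {set C} -> R) (S A B : {set C}).

Definition nonneg_antitone_supermodular u :=
  [/\ forall S, 0 <= u S, forall A B, A \subset B -> u B <= u A
    & forall A B, u A + u B <= u (A :|: B) + u (A :&: B)].

(** Chebyshev-like argument: the sum of u v over the union and the intersection
exceeds its sum over A and B by at least two products of a decrease of u and a
decrease of v, which are nonnegative. *)
Lemma nonneg_antitone_supermodular_mul u v : nonneg_antitone_supermodular u ->
  nonneg_antitone_supermodular v ->
  nonneg_antitone_supermodular (fun S => u S * v S).
Proof.
move=> [u0 u_anti u_sup] [v0 v_anti v_sup]; split=> [S|A B AB|A B].
- exact: mulr_ge0.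
- by apply: ler_pM => //; [apply: u_anti | apply: v_anti].
have IA : A :&: B \subset A by apply: subsetIl.
have IB : A :&: B \subset B by apply: subsetIr.
have AU : A \subset A :|: B by apply: subsetUl.
have BU : B \subset A :|: B by apply: subsetUr.
have H1 := ler_wpM2l (u0 (A :&: B)) (v_sup A B).
have H2 : 0 <= (u (A :&: B) - u A) * (v A - v (A :|: B)).
  by rewrite mulr_ge0 ?subr_ge0// ?u_anti ?v_anti.
have H3 : 0 <= (u (A :&: B) - u B) * (v B - v (A :|: B)).
  by rewrite mulr_ge0 ?subr_ge0// ?u_anti ?v_anti.
have H4 := ler_wpM2r (v0 (A :|: B)) (u_sup A B).
lra.
Qed.

Lemma nonneg_antitone_supermodular_add_cst (c : R) u : 0 <= c ->
  nonneg_antitone_supermodular u ->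
  nonneg_antitone_supermodular (fun S => c + u S).
Proof.
move=> c0 [u0 u_anti u_sup]; split=> [S|A B AB|A B].
- exact: addr_ge0.
- by rewrite lerD2l u_anti.
- by have := u_sup A B; lra.
Qed.

Lemma nonneg_antitone_supermodular_factor (q : R) (e : C) : 0 <= q <= 1 ->
  nonneg_antitone_supermodular (fun S => if e \in S then q else 1).
Proof.
case/andP=> q0 q1; split=> [S|A B AB|A B].
- by case: ifP.
- case: (boolP (e \in A)) => [/(fintype.subsetP AB)->//|_]; by case: ifP.
- rewrite !inE; case: (e \in A); case: (e \in B) => /=; lra.
Qed.

(** Expected score at the stopping time of a chain that stops at e with
probability 1 - q e. *)
Fixpoint chain_value (s q : C -> R) (l : seq C) : R :=
  if l is e :: l' then (1 - q e) * s e + q e * chain_value s q l' else 0.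

(** With scores nonincreasing along l, the loss relative to m splits as
(m - s e) + (q e or 1) * (s e - value of the rest), where the last factor is again
a loss, relative to the smaller bound s e. *)
Lemma chain_loss_supermodular (s q : C -> R) (m : R) (l : seq C) :
  (forall e, 0 <= q e <= 1) -> (forall e, 0 <= s e) -> 0 <= m ->
  path >=%R m (map s l) ->
  nonneg_antitone_supermodular (fun S => m - chain_value s q [seq e <- l | e \in S]).
Proof.
move=> q01 s0; elim: l m => [|e l IH] m m0 /=.
  by move=> _; split=> *; rewrite subr0.
case/andP => em sl.
have -> : (fun S : {set C} => m - chain_value s q
      (if e \in S then e :: [seq e <- l | e \in S] else [seq e <- l | e \in S])) =
    fun S : {set C} => (m - s e) + (if e \in S then q e else 1) *
      (s e - chain_value s q [seq e <- l | e \in S]).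
  by apply/funext => S; case: (e \in S) => /=; ring.
apply: nonneg_antitone_supermodular_add_cst; first by rewrite subr_ge0.
apply: nonneg_antitone_supermodular_mul; first exact: nonneg_antitone_supermodular_factor.
exact: IH.
Qed.

Lemma chain_value_monotone_submodular (s q : C -> R) (l : seq C) :
  (forall e, 0 <= q e <= 1) -> (forall e, 0 <= s e) -> sorted >=%R (map s l) ->
  monotone_fun (fun S => chain_value s q [seq e <- l | e \in S]) /\
  submodular (fun S => chain_value s q [seq e <- l | e \in S]).
Proof.
move=> q01 s0 sl.
have [m m0 ml] : exists2 m, 0 <= m & path >=%R m (map s l).
  by case: l sl => [|e l] sl; [exists 0 | exists (s e) => //=; rewrite lexx].
have [_ anti sup] := chain_loss_supermodular q01 s0 m0 ml.
split=> A B; first by move=> /anti; lra.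
by have := sup A B; lra.
Qed.

Lemma chain_valueE (rho : R) (s q p : C -> R) (l : seq C) :
  (forall e, q e = rho * (1 - p e)) ->
  let e := in_tuple l in
  \sum_(j < size l) rho ^+ j * ((1 - q (tnth e j)) * s (tnth e j)) *
    \prod_(i < size l | (i < j)%N) (1 - p (tnth e i)) = chain_value s q l.
Proof.
move=> qE /=; case: l => [|x0 l']; first by rewrite big_ord0.
move: (x0 :: l') => l {l'}.
under eq_bigr => j _.
  rewrite (tnth_nth x0) /=.
  under eq_bigr => i _ do rewrite (tnth_nth x0) /=.
  over.
elim: l => [|e l IH] /=; first by rewrite big_ord0.
rewrite big_ord_recl /= expr0 mul1r big_pred0 ?mulr1//; congr (_ + _).
rewrite -IH mulr_sumr; apply: eq_bigr => j _.
rewrite big_mkcond big_ord_recl /= -big_mkcond /= exprS (qE e).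
under eq_bigl => i do rewrite /bump /= add1n ltnS.
by rewrite !add0n; ring.
Qed.

End SupermodularProducts.

Section Revenue.
Variables (R : realType) (d : measure_display) (Omega : measurableType d).
Variables (P : probability Omega R) (I : finType) (V : I -> {RV P >-> R}).
Variables (M : I -> {fset R}) (rho : R) (before : rel (call M)).
Hypotheses (rho_gt0 : 0 < rho) (rho_lt1 : rho < 1).
Hypothesis price_ge0 : forall i r, r \in M i -> 0 <= r.
Hypothesis ordered : score_order V rho before.

Let p (e : call M) : R := accept_prob V e.
Let q (e : call M) : R := rho * (1 - p e).

Lemma accept_prob_bounds e : 0 <= p e <= 1.
Proof.
have mE : measurable [set w | price e <= V (agent e) w]%classic.
  rewrite (_ : [set w | _]%classic = (V (agent e) @^-1` `[price e, +oo[)%classic).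
    by apply: measurable_funPTI.
  by apply/seteqP; split=> w /=; rewrite in_itv/= andbT.
rewrite /p /accept_prob fine_ge0 ?measure_ge0//=.
have := probability_le1 P mE; rewrite -[X in (X <= _)%E -> _]fineK ?lee_fin//.
exact: fin_num_measure.
Qed.

Let q01 e : 0 <= q e <= 1.
Proof.
have /andP[p0 p1] := accept_prob_bounds e.
rewrite /q mulr_ge0 ?subr_ge0 ?(ltW rho_gt0)//=.
by rewrite mulr_ile1 ?subr_ge0 ?gerBl ?(ltW rho_gt0) ?(ltW rho_lt1).
Qed.

Let score_denom e : 0 < p e + (1 - p e) * (1 - rho).
Proof.
have /andP[p0 p1] := accept_prob_bounds e.
have := mulr_ge0 (ltW rho_gt0) p0; move: rho_lt1; lra.
Qed.

Let score_ge0 (e : call M) : 0 <= score V rho e.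
Proof.
have /andP[p0 p1] := accept_prob_bounds e.
rewrite /score -/(p e) divr_ge0 ?(ltW (score_denom e))// mulr_ge0//.
exact: price_ge0 (fsvalP _).
Qed.

Let calls := sort before (enum (call M)).

(** Sorting commutes with filtering, so all sets S are read off one fixed sorted
list of calls; the score is chosen so that (1 - q) * score is the expected
immediate revenue price * p. *)
Lemma revenueE S : revenue V rho before S =
  chain_value (score V rho) q [seq e <- calls | e \in S].
Proof.
have [tot tr _ _] := ordered.
have <- : sort before (enum S) = [seq e <- calls | e \in S].
  rewrite filter_sort//; congr sort; rewrite enumT /enum_mem; apply: eq_filter => e.
  by [].
rewrite /revenue -(@chain_valueE _ _ rho (score V rho) q p)//; apply: eq_bigr => j _.
congr (_ * _ * _); rewrite /score -/(p _); set e := tnth _ _.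
have := score_denom e; rewrite /q => de.
by field; rewrite gt_eqF.
Qed.

Theorem revenue_monotone_submodular :
  monotone_fun (revenue V rho before) /\ submodular (revenue V rho before).
Proof.
have [tot tr _ scoreP] := ordered.
have srt : sorted >=%R (map (score V rho) calls).
  rewrite sorted_map; apply: (sub_sorted (e := before)) => [e e' /scoreP//|].
  exact: sort_sorted.
rewrite (funext revenueE).
exact: chain_value_monotone_submodular q01 score_ge0 srt.
Qed.

End Revenue.

Theorem theorem5 (R : realType) (d : measure_display) (Omega : measurableType d)
    (P : probability Omega R) (I : finType) (V : I -> {RV P >-> R})
    (N : {RV P >-> nat}) (M : I -> {fset R}) (rho : R)
    (before : rel (call M)) :
  0 < rho -> rho < 1 ->
  (forall i w, 0 <= V i w) ->
  mutually_independent V ->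
  geometric_horizon N rho ->
  horizon_independent V N ->
  (forall i r, r \in M i -> 0 <= r) ->
  score_order V rho before ->
  [/\ monotone_fun (revenue V rho before),
      submodular (revenue V rho before),
      is_partition_matroid (@feasible R I M)
    & forall (K : nat) (w : nat -> call M -> R),
        enough_steps (@feasible R I M) K ->
        accurate_weights (revenue V rho before) (@feasible R I M) K w ->
        is_approx_solution (1 - (expR 1)^-1) (revenue V rho before)
          (@feasible R I M)
          (continuous_greedy_pipage (revenue V rho before) (@feasible R I M) K w)].
Proof.
move=> rho_gt0 rho_lt1 _ _ _ _ price_ge0 ordered.
have [mono sub] := revenue_monotone_submodular rho_gt0 rho_lt1 price_ge0 ordered.
(* Feasibility is, by definition, independence with the agents as classes. *)
rewrite -[@feasible R I M]/(one_per_class (@agent R I M)).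
split=> //; first exact: one_per_class_partition_matroid.
move=> K w steps accurate.
have rev0 : revenue V rho before set0 = 0.
  by rewrite revenueE// (eq_filter (a2 := pred0)) ?filter_pred0// => e; rewrite inE.
have matroid := one_per_class_matroid (@agent R I M).
have [K_gt0 _] := steps.
have [feas greedy_le] := pipage_roundP sub
  (continuous_greedy_class_distribution (@agent R I M) w K_gt0).
split=> // S' feasS'; apply: le_trans greedy_le.
apply: le_trans (continuous_greedy_approx mono sub rev0 matroid steps accurate).
rewrite ler_wpM2l ?indep_le_opt// subr_ge0; have := inv_expR1_le R; lra.
Qed.
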